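(* Let $A, B \in \mathbb{M}_n$, and assume that if zero is an eigenvalue of $AB$, then it is a semi-simple eigenvalue of $AB$. Then the following statements are equivalent: (i) $\det(I + \tau AB) \neq 0$ for all real $\tau \geq 0$; (ii) there exist $H \in \mathbb{M}_n$ and $\varepsilon > 0$ such that the Hermitian matrix $$P = \begin{bmatrix} 0 & H \\ H^* & 0 \end{bmatrix} \in \mathbb{H}_{2n}$$ satisfies $$\begin{bmatrix} I & -A^* \end{bmatrix} P \begin{bmatrix} I \\ -A \end{bmatrix} \preceq -\varepsilon A^*A \quad\text{and}\quad \begin{bmatrix} B^* & I \end{bmatrix} P \begin{bmatrix} B \\ I \end{bmatrix} \succeq 0;$$ (iii) $\lambda(AB) \cap (-\infty, 0) = \emptyset$.
   Context: $\mathbb{M}_n$ is the set of complex $n\times n$ matrices, $\mathbb{H}_{2n}$ the set of Hermitian $2n\times 2n$ matrices, $\cdot^*$ the conjugate transpose, and $\lambda(\cdot)$ the set of eigenvalues. $\preceq,\succeq$ denote the Loewner order on Hermitian matrices. An eigenvalue is semi-simple if its algebraic and geometric multiplicities coincide. *)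

(* Defs.v *)
From mathcomp Require Import all_boot all_order all_algebra.
From mathcomp Require Import sesquilinear spectral complex.
From mathcomp Require Import reals.

Set Implicit Arguments.
Unset Strict Implicit.
Unset Printing Implicit Defensive.

Import Order.TTheory GRing.Theory Num.Theory.

Local Open Scope ring_scope.
Local Open Scope sesquilinear_scope.

(* The order on a numClosedFieldType is partial: 0 <= z says that z is real
   and nonnegative. *)
Definition psdmx (C : numClosedFieldType) (n : nat) (M : 'M[C]_n) : Prop :=
  M \is hermsymmx /\ forall x : 'cV[C]_n, 0 <= (x ^t* *m M *m x) 0 0.

Definition loewner_le (C : numClosedFieldType) (n : nat) (M N : 'M[C]_n) : Prop :=
  psdmx (N - M).

(* eigenspace is the space of row eigenvectors; it has the same dimension as
   the space of column eigenvectors for the same scalar. *)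
Definition semisimple_at (F : fieldType) (n : nat) (M : 'M[F]_n) (a : F) : Prop :=
  mup a (char_poly M) = \rank (eigenspace M a).

(* Main.v *)
Require Import Defs.
From mathcomp Require Import all_boot all_order all_algebra.
From mathcomp Require Import sesquilinear spectral complex.
From mathcomp Require Import reals.
From mathcomp Require Import ring.

Set Implicit Arguments.
Unset Strict Implicit.
Unset Printing Implicit Defensive.

Import Order.TTheory GRing.Theory Num.Theory.

Local Open Scope ring_scope.
Local Open Scope sesquilinear_scope.

(** Put M = A B.  The substitution H = A^* K reduces the two matrix inequalities
    to conditions on M alone: K + K^* is at least epsilon I, and M^* K + K^* M
    is positive semidefinite.  Such a K is called a multiplier here, and the
    main point is that one exists when M has no negative eigenvalue and zero is
    semi-simple.

    A scalar a outside the closed negative half-line has a multiplier: halving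
    its argument gives k = |a| + a, for which both k and conj(k) a lie in the
    open right half-plane (lemma halving_direction).  A triangular matrix with
    such diagonal entries is handled one row at a time: the multiplier is block
    diagonal, and the scalar block is scaled up until it absorbs the
    off-diagonal coupling (lemma trig_multiplier).  The multiplier conditions
    are preserved by unitary conjugation, so the Schur form extends this to
    every matrix whose eigenvalues avoid the closed negative half-line (lemma
    coercive_multiplier).

    In general, take a full-rank factorization M = L N.  Comparing the
    characteristic polynomials of L N and N L shows that the core N L is
    invertible when zero is semi-simple (lemma semisimple0_core_unit).  Each
    eigenvalue of the core is then a nonzero eigenvalue of M, so the core has a
    multiplier.  As I = L (N L)^-1 N + Q with Q M = 0, this multiplier pulled
    back by N, plus Q^* Q, is one for M (lemma semisimple_multiplier).

    Conversely, if M v = t v with t negative, then at w = B v the first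
    inequality gives 2 t Re(w^* H v) >= epsilon t^2 |v|^2, while the second
    gives Re(w^* H v) >= 0, so v = 0. *)

(** * Conjugate transposes, inner products and squared norms *)

Section Certificates.
Context {C : numClosedFieldType}.

Lemma trmxC_mul m n p (A : 'M[C]_(m, n)) (B : 'M[C]_(n, p)) :
  (A *m B)^t* = B^t* *m A^t*.
Proof. by rewrite trmx_mul map_mxM. Qed.

Lemma trmxCD m n (A B : 'M[C]_(m, n)) : (A + B)^t* = A^t* + B^t*.
Proof. by rewrite linearD map_mxD. Qed.

Lemma trmxCN m n (A : 'M[C]_(m, n)) : (- A)^t* = - A^t*.
Proof. by rewrite linearN map_mxN. Qed.

Lemma trmxCZ m n a (A : 'M[C]_(m, n)) : (a *: A)^t* = a^* *: A^t*.
Proof. by rewrite linearZ map_mxZ. Qed.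

Definition cdot n (x y : 'cV[C]_n) : C := (x^t* *m y) 0 0.

Definition sqnorm n (x : 'cV[C]_n) : C := cdot x x.

Lemma cdotDl n (x y z : 'cV[C]_n) : cdot (x + y) z = cdot x z + cdot y z.
Proof. by rewrite /cdot trmxCD mulmxDl mxE. Qed.

Lemma cdotDr n (x y z : 'cV[C]_n) : cdot x (y + z) = cdot x y + cdot x z.
Proof. by rewrite /cdot mulmxDr mxE. Qed.

Lemma cdotZl n a (x y : 'cV[C]_n) : cdot (a *: x) y = a^* * cdot x y.
Proof. by rewrite /cdot trmxCZ -scalemxAl mxE. Qed.

Lemma cdotZr n a (x y : 'cV[C]_n) : cdot x (a *: y) = a * cdot x y.
Proof. by rewrite /cdot -scalemxAr mxE. Qed.

Lemma cdotC n (x y : 'cV[C]_n) : cdot y x = (cdot x y)^*.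
Proof.
rewrite /cdot -[in LHS](trmxCK x) -trmxC_mul.
by rewrite !mxE.
Qed.

Lemma cdot_mull m n (A : 'M[C]_(m, n)) (x : 'cV[C]_n) (y : 'cV[C]_m) :
  cdot (A *m x) y = cdot x (A^t* *m y).
Proof. by rewrite /cdot trmxC_mul mulmxA. Qed.

Lemma cdot_col m n (x x' : 'cV[C]_m) (y y' : 'cV[C]_n) :
  cdot (col_mx x y) (col_mx x' y') = cdot x x' + cdot y y'.
Proof. by rewrite /cdot tr_col_mx map_row_mx mul_row_col mxE. Qed.

Lemma sqnorm_col m n (x : 'cV[C]_m) (y : 'cV[C]_n) :
  sqnorm (col_mx x y) = sqnorm x + sqnorm y.
Proof. exact: cdot_col. Qed.

Lemma sqnormE n (x : 'cV[C]_n) : sqnorm x = \sum_i x i 0 * (x i 0)^*.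
Proof.
by rewrite /sqnorm /cdot mxE; apply: eq_bigr => i _; rewrite !mxE mulrC.
Qed.

Lemma sqnorm_ge0 n (x : 'cV[C]_n) : 0 <= sqnorm x.
Proof. by rewrite sqnormE sumr_ge0 // => i _; apply: mul_conjC_ge0. Qed.

Lemma Re_mul_sqnorm n a (x : 'cV[C]_n) : 'Re (a * sqnorm x) = 'Re a * sqnorm x.
Proof. by rewrite ReMr //; apply/ger0_real/sqnorm_ge0. Qed.

Lemma sqnorm_eq0 n (x : 'cV[C]_n) : sqnorm x = 0 -> x = 0.
Proof.
rewrite sqnormE => /psumr_eq0P x0; apply/matrixP => i j; rewrite ord1 mxE.
apply/eqP; rewrite -mul_conjC_eq0; apply/eqP/x0 => // k _.
exact: mul_conjC_ge0.
Qed.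

Lemma sqnormD n (x y : 'cV[C]_n) :
  sqnorm (x + y) = sqnorm x + sqnorm y + 2 * 'Re (cdot x y).
Proof.
rewrite /sqnorm cdotDl !cdotDr [cdot y x]cdotC ReE.
by field.
Qed.

Lemma sqnormZ n a (x : 'cV[C]_n) : sqnorm (a *: x) = a * a^* * sqnorm x.
Proof. by rewrite /sqnorm cdotZl cdotZr; ring. Qed.

(** By the parallelogram law, the defect is the squared norm of x - y. *)
Lemma sqnormD_le n (x y : 'cV[C]_n) :
  sqnorm (x + y) <= 2 * (sqnorm x + sqnorm y).
Proof.
rewrite -subr_ge0.
have -> : 2 * (sqnorm x + sqnorm y) - sqnorm (x + y) = sqnorm (x + (-1) *: y).
  by rewrite !sqnormD sqnormZ cdotZr rmorphN1 !mulN1r raddfN /=; ring.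
exact: sqnorm_ge0.
Qed.

(** Young's inequality for a cross term, from the nonnegativity of the squared
    norm of d x + y. *)
Lemma Re_cdot_ge n (d : C) (x y : 'cV[C]_n) : 0 < d ->
  - (d * sqnorm x + d^-1 * sqnorm y) <= 2 * 'Re (cdot x y).
Proof.
move=> d0; have dn0 : d != 0 by rewrite gt_eqF.
have dC : d^* = d by apply/CrealP/gtr0_real.
have Rd : d \is Num.real by apply/gtr0_real.
rewrite -subr_ge0 -(pmulr_rge0 _ d0).
have := sqnorm_ge0 (d *: x + y).
rewrite sqnormD sqnormZ cdotZl dC ReMl //.
by congr (_ <= _); field.
Qed.

(** Boundedness of linear maps, by adding one column at a time. *)
Lemma sqnorm_mul_le m n (A : 'M[C]_(m, n)) :
  exists2 c, 0 <= c & forall x, sqnorm (A *m x) <= c * sqnorm x.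
Proof.
elim: n A => [|n IHn]; last rewrite -[n.+1]/(1 + n)%N.
  move=> A; exists 0 => // x; rewrite thinmx0 mul0mx mul0r.
  by rewrite /sqnorm /cdot mulmx0 mxE.
move=> A; rewrite -[A]hsubmxK; move: (lsubmx A) (rsubmx A) => a {}A.
have {IHn} [c c0 Hc] := IHn A.
exists (2 * (sqnorm a + c)) => [|x].
  by rewrite mulr_ge0 ?addr_ge0 ?sqnorm_ge0.
rewrite -[x]vsubmxK mul_row_col; move: (usubmx x) (dsubmx x) => s y.
rewrite [s]mx11_scalar mul_mx_scalar; move: (s 0 0) => {}s.
apply: (le_trans (sqnormD_le _ _)); rewrite -mulrA ler_pM2l ?ltr0n //.
rewrite sqnormZ sqnorm_col.
have -> : sqnorm (s%:M : 'cV_1) = s * s^*.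
  by rewrite sqnormE big_ord1 !mxE eqxx mulr1n.
apply: (le_trans (lerD (lexx _) (Hc y))); rewrite -subr_ge0.
have -> : (sqnorm a + c) * (s * s^* + sqnorm y)
    - (s * s^* * sqnorm a + c * sqnorm y)
    = sqnorm a * sqnorm y + c * (s * s^*) by ring.
by rewrite addr_ge0 // mulr_ge0 ?sqnorm_ge0 ?mul_conjC_ge0.
Qed.

(** * Multipliers *)

(** Half of the Hermitian form of M + M^* dominates d |x|^2; with d = 0 this
    says that M + M^* is positive semidefinite. *)
Definition coercive n (M : 'M[C]_n) (d : C) :=
  forall x, d * sqnorm x <= 'Re (cdot x (M *m x)).

(** The witness |a| + a has half the argument of a, so it points strictly within
    a right angle both of the positive axis and of a. *)
Lemma halving_direction (a : C) : ~~ (a <= 0) ->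
  exists2 k, 0 < 'Re k & 0 < 'Re (k^* * a).
Proof.
move=> a_le0.
have Rea : 0 < `|a| + 'Re a.
  rewrite -[a in 'Re a]opprK raddfN subr_gt0 -normrN.
  by rewrite (lt_leif (leif_Re_Creal (- a))) oppr_ge0.
have na : 0 < `|a| by rewrite normr_gt0; apply: contraNneq a_le0 => ->.
have Rna : `|a| \is Num.real by rewrite normr_real.
exists (`|a| + a); first by rewrite raddfD /= (Creal_ReP _ _).
rewrite rmorphD /= (CrealP Rna) mulrDl [_^* * a]mulrC -normCK raddfD /= ReMl //.
by rewrite addrC (Creal_ReP _ _) ?rpredX // expr2 -mulrDr mulr_gt0 // addrC.
Qed.

(** Induction on the blocks [x 0; b J'], with multiplier diag(c k, K').  On a
    vector (y, z) the only cross term is z^* K'^* b y.  By Young's inequality it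
    costs at most half of the coercivity available in z and a fixed multiple of
    |y|^2, which a large c compensates. *)
Lemma trig_multiplier n (J : 'M[C]_n) : is_trig_mx J ->
    (forall i, ~~ (J i i <= 0)) ->
  exists (K : 'M[C]_n) (d : C),
    [/\ 0 < d, coercive K d & coercive (K^t* *m J) d].
Proof.
elim/trigsqmx_ind => {J} [_|{}n x b J' _ IHn dJ].
  by exists 0, 1; split=> [|y|y]; rewrite ?ltr01 // (flatmx0 y) /sqnorm /cdot
    !mulmx0 !mxE mulr0 raddf0.
have [] := IHn.
  by move=> i; have := dJ (rshift 1 i); rewrite block_mxEdr.
move=> K' [d [d0 HK HKJ]].
have [k k0 ka] := halving_direction (dJ (lshift n 0)).
move: ka; rewrite block_mxEul; set a := x 0 0 => ka.
have [s s0 Hs] := sqnorm_mul_le (K'^t* *m b).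
have dn0 : d != 0 by rewrite gt_eqF.
have d20 : 0 < d / 2 by rewrite divr_gt0.
have sd0 : 0 <= s / (2 * d) by rewrite divr_ge0 // mulr_ge0 // ltW.
have m0 : 0 <= d / 2 + s / (2 * d) by rewrite addr_ge0 // ltW.
(* The sum of the two reciprocals dominates each of them, so that c Re k and
   c Re (conj k a) are both large enough. *)
pose c := (d / 2 + s / (2 * d)) * (('Re k)^-1 + ('Re (k^* * a))^-1).
have c0 : 0 <= c by rewrite mulr_ge0 // addr_ge0 // invr_ge0 ltW.
have ck : d / 2 <= c * 'Re k.
  rewrite /c -mulrA [_ * 'Re k]mulrDl mulVf ?gt_eqF //.
  rewrite -[d/2 in X in X <= _]mulr1.
  by rewrite ler_pM ?lerDl // ?mulr_ge0 ?invr_ge0 // ltW.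
have ca : d / 2 + s / (2 * d) <= c * 'Re (k^* * a).
  rewrite /c -mulrA [_ * 'Re (_ * _)]mulrDl [X in _ * (_ + X)]mulVf ?gt_eqF //.
  rewrite ler_peMr //.
  by rewrite lerDr mulr_ge0 ?invr_ge0 ?ltW.
have Rc : c \is Num.real by apply: ger0_real.
have cC : c^* = c by apply/CrealP.
have ReMc t : 'Re (c * t) = c * 'Re t by rewrite ReMl.
exists (block_mx (c * k)%:M 0 0 K'), (d / 2); split=> // y.
  rewrite -[y]vsubmxK; move: (usubmx y) (dsubmx y) => {}y z.
  rewrite mul_block_col !mul0mx addr0 add0r cdot_col sqnorm_col.
  rewrite mul_scalar_mx cdotZr raddfD /= -/(sqnorm y) Re_mul_sqnorm ReMc.
  rewrite mulrDr lerD // ?ler_wpM2r ?sqnorm_ge0 //.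
  apply: le_trans (HK z); rewrite ler_wpM2r ?sqnorm_ge0 //.
  by rewrite ler_pdivrMr // ler_peMr ?ltW // ltr1n.
rewrite -[y]vsubmxK; move: (usubmx y) (dsubmx y) => {}y z.
rewrite tr_block_mx map_block_mx !trmx0 !map_mx0.
rewrite mulmx_block !mul0mx !mulmx0 !addr0 !add0r.
rewrite mul_block_col !mul0mx addr0 cdot_col sqnorm_col.
rewrite [x]mx11_scalar -/a tr_scalar_mx map_scalar_mx -scalar_mxM mul_scalar_mx.
rewrite cdotZr cdotDr !raddfD /= rmorphM /= cC -[c * _ * a]mulrA.
rewrite -/(sqnorm y) Re_mul_sqnorm ReMc.
have Hcr := Re_cdot_ge z (K'^t* *m b *m y) d0.
have {}Hcr : - (d / 2 * sqnorm z + s / (2 * d) * sqnorm y)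
    <= 'Re (cdot z (K'^t* *m b *m y)).
  rewrite -(ler_pM2l (ltr0n C 2)) (le_trans _ Hcr) // mulrN lerN2.
  have -> : 2 * (d / 2 * sqnorm z + s / (2 * d) * sqnorm y)
      = d * sqnorm z + d^-1 * (s * sqnorm y) by field.
  by rewrite lerD2l ler_wpM2l ?Hs // invr_ge0 ltW.
have -> : d / 2 * (sqnorm y + sqnorm z) = (d / 2 + s / (2 * d)) * sqnorm y
    + (- (d / 2 * sqnorm z + s / (2 * d) * sqnorm y) + d * sqnorm z) by field.
by rewrite !lerD // ler_wpM2r ?sqnorm_ge0.
Qed.

(** A unitary change of basis preserves squared norms, hence coercivity
    constants, so the Schur triangular form suffices; its diagonal consists of
    eigenvalues of M. *)
Lemma coercive_multiplier n (M : 'M[C]_n) :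
    (forall a, a <= 0 -> ~~ eigenvalue M a) ->
  exists (K : 'M[C]_n) (d : C),
    [/\ 0 < d, coercive K d & coercive (K^t* *m M) d].
Proof.
move=> HM; have [n0|n_gt0] := posnP n.
  by subst n; apply: trig_multiplier => [|[]//]; apply/is_trig_mxP => -[].
have [V Vu] := Schur M n_gt0.
rewrite /similar_to conjymx //; set J := V *m M *m V^t* => Jtrig.
have VV : V^t* *m V = 1%:M by rewrite -invmx_unitary // mulVmx ?unitarymx_unit.
have dJ i : ~~ (J i i <= 0).
  apply/negP => /HM /negP; apply.
  have : eigenvalue J (J i i).
    rewrite eigenvalue_root_char char_poly_trig // -dvdp_XsubCl.
    by rewrite (bigD1 i) //= dvdp_mulr.
  case/eigenvalueP => u uJ u0; apply/eigenvalueP; exists (u *m V).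
    by rewrite scalemxAl -uJ /J !mulmxA -(mulmxA _ _ V) VV mulmx1.
  by rewrite mulmx_free_eq0 // row_free_unit unitarymx_unit.
have [K [d [d0 HK HKJ]]] := trig_multiplier Jtrig dJ.
have nV x : sqnorm (V *m x) = sqnorm x.
  by rewrite /sqnorm cdot_mull mulmxA VV mul1mx.
exists (V^t* *m K *m V), d; split=> // x; rewrite -nV.
  by rewrite -!mulmxA -cdot_mull; apply: HK.
apply: le_trans (HKJ _) _; rewrite le_eqVlt; apply/orP; left; apply/eqP.
rewrite cdot_mull !trmxC_mul trmxCK /J !mulmxA.
by rewrite -[_ *m V^t* *m V]mulmxA VV mulmx1.
Qed.

(** * Splitting off a semi-simple zero eigenvalue *)

(** Sylvester's determinant identity.  Both sides are the determinant of
    [a L; N 1] multiplied by a power of a, computed by eliminating one of the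
    off-diagonal blocks.  The ring is arbitrary so that a can be an
    indeterminate. *)
Lemma det_sylvester (F : comNzRingType) m n
    (L : 'M[F]_(m, n)) (N : 'M[F]_(n, m)) a :
  a ^+ n * \det (a%:M - L *m N) = a ^+ m * \det (a%:M - N *m L).
Proof.
have E1 : block_mx a%:M L N 1%:M *m block_mx 1%:M 0 (- N) 1%:M
    = block_mx (a%:M - L *m N) L 0 1%:M.
  by rewrite mulmx_block !mulmx1 !mul1mx !mulmx0 !mulmxN subrr !add0r.
have E2 : block_mx a%:M L N 1%:M *m block_mx 1%:M (- L) 0 a%:M
    = block_mx a%:M 0 N (a%:M - N *m L).
  rewrite mulmx_block !mulmx1 !mul1mx !mulmx0 !mulmxN !addr0.
  by rewrite scalar_mxC addNr addrC.
have := congr1 determinant E1; have := congr1 determinant E2.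
rewrite !det_mulmx !det_ublock !det_lblock !det1 !det_scalar !mul1r !mulr1.
by move=> <- <-; rewrite mulrC.
Qed.

(** Write M = L N with L = col_base M and N = row_base M of rank r.  Sylvester's
    identity says that X^r char_poly (L N) = X^n char_poly (N L).  The
    hypothesis makes n - r the multiplicity of 0 in char_poly (L N), also when 0
    is not an eigenvalue, where both are 0.  This leaves multiplicity 0 for
    char_poly (N L). *)
Lemma semisimple0_core_unit n (M : 'M[C]_n) :
  (eigenvalue M 0 -> semisimple_at M 0) -> row_base M *m col_base M \in unitmx.
Proof.
move=> ss.
have {ss} mup0 : mup 0 (char_poly M) = (n - \rank M)%N.
  have [/ss ->|] := boolP (eigenvalue M 0).
    by rewrite /eigenspace raddf0 subr0 mxrank_ker.
  move=> E0; rewrite mupNroot -?eigenvalue_root_char //.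
  rewrite /eigenvalue negbK /eigenspace raddf0 subr0 in E0.
  by rewrite -mxrank_ker (eqP E0) mxrank0.
set M1 := row_base M *m col_base M.
have : 'X^(\rank M) * char_poly M = 'X^n * char_poly M1.
  have := det_sylvester (map_mx polyC (col_base M)) (map_mx polyC (row_base M)).
  by move/(_ 'X); rewrite -!map_mxM mulmx_base.
have X0 k : ('X^k : {poly C}) != 0 by rewrite monic_neq0 ?monicXn.
have P0 k (A : 'M[C]_k) : char_poly A != 0.
  by rewrite monic_neq0 ?char_poly_monic.
have mupX k : mup 0 ('X^k : {poly C}) = k.
  by have := mup_XsubCX k (0 : C) 0; rewrite subr0 eqxx.
move/(congr1 (mup 0)); rewrite !mupM // !mupX mup0 subnKC ?rank_leq_row //.
move=> /eqP; rewrite -{1}[n]addn0 eqn_add2l eq_sym => /eqP m10.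
have : ~~ eigenvalue M1 0.
  by rewrite eigenvalue_root_char -dvdp_XsubCl XsubC_dvd // m10.
by rewrite /eigenvalue negbK /eigenspace raddf0 subr0 kermx_eq0 row_free_unit.
Qed.

(** With L' = L (N L)^-1 the vector x is recovered from N x and Q x as
    L' (N x) + Q x, which makes the pulled-back multiplier coercive on the whole
    space.  Only semidefiniteness survives for K^* M, since M vanishes on its
    kernel. *)
Lemma semisimple_multiplier n (M : 'M[C]_n) :
    (eigenvalue M 0 -> semisimple_at M 0) ->
    (forall a, a < 0 -> ~~ eigenvalue M a) ->
  exists (K : 'M[C]_n) (d : C),
    [/\ 0 < d, coercive K d & coercive (K^t* *m M) 0].
Proof.
move=> ss HM; have M1u := semisimple0_core_unit ss.
have defM := mulmx_base M.
have Nfree := row_base_free M.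
move: (\rank M) (col_base M) (row_base M) M1u defM Nfree.
move=> r L N M1u defM Nfree.
set M1 := N *m L in M1u.
have [|K1 [d [d0 HK HKM]]] := @coercive_multiplier _ M1.
  move=> a a_le0; apply/negP; case: (eqVneq a 0) => [->|a0].
    by rewrite /eigenvalue /eigenspace raddf0 subr0 kermx_eq0 row_free_unit M1u.
  case/eigenvalueP => u uM u0; have /HM/negP : a < 0 by rewrite lt_neqAle a0.
  apply; apply/eigenvalueP; exists (u *m N); last by rewrite mulmx_free_eq0.
  by rewrite -defM scalemxAl -uM /M1 !mulmxA.
pose L' := L *m invmx M1.
have [Q QM QE] : exists2 Q, Q *m M = 0 & L' *m N + Q = 1%:M.
  exists (1%:M - L' *m N); last by rewrite addrC subrK.
  rewrite mulmxBl mul1mx -[in X in _ - X]defM /L' !mulmxA.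
  by rewrite -(mulmxA _ N L) mulmxKV // defM subrr.
have NM : N *m M = M1 *m N by rewrite -[in LHS]defM mulmxA.
have [c c0 Hc] := sqnorm_mul_le L'.
have cd0 : 0 < c + d by rewrite ltr_wpDl.
(* This e satisfies both 2 e c <= d and 2 e <= 1. *)
pose e := d / (2 * (c + d)).
have e0 : 0 < e by rewrite divr_gt0 // mulr_gt0 // ltr0n.
have formK (S : 'M_n) x : cdot x ((N^t* *m K1 *m N + Q^t* *m Q)^t* *m S *m x)
    = cdot (K1 *m (N *m x)) (N *m (S *m x)) + cdot (Q *m x) (Q *m (S *m x)).
  rewrite trmxCD !trmxC_mul !trmxCK !mulmxDl cdotDr -!mulmxA.
  by rewrite !(cdot_mull K1, cdot_mull N, cdot_mull Q).
exists (N^t* *m K1 *m N + Q^t* *m Q), e; split=> // x; last first.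
  rewrite mul0r formK (mulmxA N M) NM (mulmxA Q M) QM mul0mx.
  rewrite [X in _ + X]/cdot mulmx0 mxE addr0 (cdot_mull K1).
  rewrite -(mulmxA M1) (mulmxA (K1^t*) M1); apply: le_trans (HKM _).
  by rewrite mulr_ge0 ?sqnorm_ge0 ?ltW.
have -> : 'Re (cdot x ((N^t* *m K1 *m N + Q^t* *m Q) *m x))
    = 'Re (cdot (N *m x) (K1 *m (N *m x))) + sqnorm (Q *m x).
  rewrite mulmxDl cdotDr raddfD -!mulmxA -!cdot_mull /=; congr (_ + _).
  by apply/Creal_ReP/ger0_real/sqnorm_ge0.
apply: le_trans (lerD (HK _) (lexx _)).
have xE : x = L' *m (N *m x) + Q *m x.
  by rewrite mulmxA -mulmxDl QE mul1mx.
apply: (@le_trans _ _ (e * (2 * (c * sqnorm (N *m x) + sqnorm (Q *m x))))).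
  rewrite ler_pM2l // {1}xE; apply: le_trans (sqnormD_le _ _) _.
  by rewrite ler_pM2l ?ltr0n // lerD2r.
have cdn0 : c + d != 0 by rewrite gt_eqF.
have -> : e * (2 * (c * sqnorm (N *m x) + sqnorm (Q *m x)))
   = c / (c + d) * (d * sqnorm (N *m x)) + d / (c + d) * sqnorm (Q *m x).
  by rewrite /e; field.
by rewrite lerD // ler_piMl ?mulr_ge0 ?sqnorm_ge0 ?(ltW d0) //
  ler_pdivrMr // mul1r ?lerDl ?lerDr // ltW.
Qed.

(** * From matrix inequalities to coercivity and eigenvalues *)

Lemma psdmx_symmetrized n (S : 'M[C]_n) :
  psdmx (S + S^t*) <-> coercive S 0.
Proof.
have formS x : (x^t* *m (S + S^t*) *m x) 0 0 = 2 * 'Re (cdot x (S *m x)).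
  rewrite mulmxDr mulmxDl mxE -!mulmxA -!/(cdot _ _) -cdot_mull.
  by rewrite [cdot (S *m x) x]cdotC ReE; field.
split=> [[_ H] x|H].
  by rewrite mul0r -(pmulr_rge0 _ (ltr0n C 2)) -formS.
split=> [|x].
  by apply/is_hermitianmxP; rewrite expr0 scale1r trmxCD trmxCK addrC.
by have := H x; rewrite formS mul0r -(pmulr_rge0 _ (ltr0n C 2)).
Qed.

Lemma Re_cdot_trmxC n (S : 'M[C]_n) (x : 'cV[C]_n) :
  'Re (cdot x (S^t* *m x)) = 'Re (cdot x (S *m x)).
Proof. by rewrite -cdot_mull cdotC Re_conj. Qed.

(** Evaluates the form of the first matrix inequality; the coefficient c stands
    for half of epsilon, as coercive sees only half of the Hermitian form. *)
Lemma Re_cdot_defect n (H A : 'M[C]_n) c (x : 'cV[C]_n) : c \is Num.real ->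
  'Re (cdot x ((H *m A - c *: (A^t* *m A)) *m x))
  = 'Re (cdot x (H *m (A *m x))) - c * sqnorm (A *m x).
Proof.
move=> Rc; rewrite mulmxDl -scaleNr -scalemxAl cdotDr cdotZr raddfD -!mulmxA /=.
by rewrite -[cdot x (A^t* *m _)]cdot_mull -/(sqnorm _) Re_mul_sqnorm
  (Creal_ReP (- c) _) ?mulNr // rpredN.
Qed.

Lemma eigenvalue_unitmx (F : fieldType) n (M : 'M[F]_n) a :
  eigenvalue M a = (M - a%:M \notin unitmx).
Proof. by rewrite /eigenvalue kermx_eq0 row_free_unit. Qed.

(** eigenvalue is defined through row vectors, while the Hermitian forms are
    evaluated on column vectors. *)
Lemma eigenvalue_col (F : fieldType) n (M : 'M[F]_n) a : eigenvalue M a ->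
  exists2 v : 'cV_n, M *m v = a *: v & v != 0.
Proof.
move=> Ma; have /eigenvalueP[u uM u0] : eigenvalue M^T a.
  rewrite eigenvalue_unitmx -[a%:M]tr_scalar_mx -raddfB unitmx_tr.
  by rewrite -eigenvalue_unitmx.
exists u^T; last by rewrite trmx_eq0.
by apply: trmx_inj; rewrite trmx_mul linearZ /= trmxK.
Qed.

Lemma det_addZ_eq0 (F : fieldType) n (M : 'M[F]_n) (t : F) : t != 0 ->
  (\det (1%:M + t *: M) == 0) = eigenvalue M (- t^-1).
Proof.
move=> t0; rewrite eigenvalue_unitmx unitmxE unitfE negbK.
have -> : 1%:M + t *: M = t *: (M - (- t^-1)%:M).
  by rewrite scalerBr scale_scalar_mx mulrN divff // raddfN opprK addrC.
by rewrite detZ mulf_eq0 expf_eq0 (negPf t0) andbF.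
Qed.

End Certificates.

(** * The equivalence *)

Local Open Scope complex_scope.

Lemma det_pencil_eq0 (R : realType) n (M : 'M[R[i]]_n) (t : R) : t < 0 ->
  (\det (1%:M + (- t^-1)%:C *: M) == 0) = eigenvalue M t%:C.
Proof.
move=> t0.
have tC0 : t%:C != 0 by rewrite lt_eqF // ltcR.
have -> : (- t^-1)%:C = - (t%:C)^-1 by rewrite rmorphN fmorphV.
rewrite det_addZ_eq0; last by rewrite oppr_eq0 invr_eq0.
by rewrite invrN invrK opprK.
Qed.

Theorem mainTheorem1 (R : realType) (n : nat) (A B : 'M[R[i]]_n)
    (hAB : eigenvalue (A *m B) 0 -> semisimple_at (A *m B) 0) :
  [<->
    (forall tau : R, 0 <= tau -> \det (1%:M + tau%:C *: (A *m B)) != 0);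
    (exists (H : 'M[R[i]]_n) (eps : R), 0 < eps /\
      let P : 'M[R[i]]_(n + n) := block_mx 0 H (H ^t*) 0 in
      loewner_le (row_mx 1%:M (- A ^t*) *m P *m col_mx 1%:M (- A))
                 (- (eps%:C *: (A ^t* *m A))) /\
      loewner_le 0 (row_mx (B ^t*) 1%:M *m P *m col_mx B 1%:M));
    (forall t : R, t < 0 -> ~~ eigenvalue (A *m B) t%:C)].
Proof.
have formA (H : 'M[R[i]]_n) (eps : R) :
    - (eps%:C *: (A^t* *m A)) -
    row_mx 1%:M (- A ^t*) *m block_mx 0 H (H ^t*) 0 *m col_mx 1%:M (- A)
    = (H *m A - (eps / 2)%:C *: (A^t* *m A))
      + (H *m A - (eps / 2)%:C *: (A^t* *m A))^t*.
  rewrite mul_row_block mul_row_col !mulmx0 !mul1mx mulmx1 add0r addr0.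
  rewrite mulmxN mulNmx opprD !opprK trmxCD trmxCN trmxCZ !trmxC_mul trmxCK.
  have -> : ((eps / 2)%:C^* = (eps / 2)%:C)%R.
    by apply/CrealP/complex_realP; exists (eps / 2).
  rewrite addrACA -opprD -scalerDl -rmorphD -splitr /= addrC.
  by rewrite (addrC (H *m A)).
have formB (H : 'M[R[i]]_n) :
    row_mx (B ^t*) 1%:M *m block_mx 0 H (H ^t*) 0 *m col_mx B 1%:M - 0
    = B^t* *m H + (B^t* *m H)^t*.
  rewrite subr0 mul_row_block mul_row_col !mulmx0 !mul1mx mulmx1 add0r addr0.
  by rewrite trmxC_mul trmxCK addrC.
rewrite /loewner_le; tfae.
- move=> Hdet.
  have [|K [d [d0 HK HKM]]] := semisimple_multiplier hAB.
    move=> a a0; have /complex_realP[t tE] := ltr0_real a0; subst a.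
    have t0 : t < 0 by move: a0; rewrite ltcR.
    have := Hdet (- t^-1); rewrite oppr_ge0 invr_le0 ltW // => /(_ isT).
    by rewrite det_pencil_eq0.
  have /complex_realP[e dE] := gtr0_real d0; subst d.
  have e0 : 0 < e by move: d0; rewrite ltcR.
  exists (A^t* *m K), e; split=> //; rewrite formA formB !psdmx_symmetrized.
  split=> x; last first.
    have -> : B^t* *m (A^t* *m K) = (K^t* *m (A *m B))^t*.
      by rewrite !trmxC_mul trmxCK mulmxA.
    by rewrite Re_cdot_trmxC; apply: HKM.
  rewrite mul0r Re_cdot_defect; last by apply/complex_realP; exists (e / 2).
  rewrite -[A^t* *m K *m _]mulmxA -cdot_mull subr_ge0.
  apply: le_trans (HK _); rewrite ler_wpM2r ?sqnorm_ge0 // lecR.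
  by rewrite ler_pdivrMr // ler_peMr ?ler1n // ltW.
- case=> H [e [e0 []]]; rewrite formA formB !psdmx_symmetrized => HA HB t t0.
  apply/negP => /eigenvalue_col[v ABv v0].
  have AwE : A *m (B *m v) = t%:C *: v by rewrite mulmxA.
  have := HA (B *m v); rewrite mul0r Re_cdot_defect; last first.
    by apply/complex_realP; exists (e / 2).
  have Rt : t%:C \is Num.real by apply/complex_realP; exists t.
  rewrite AwE -scalemxAr cdotZr ReMl // sqnormZ (CrealP Rt) cdot_mull mulmxA.
  apply/negP/negbT/lt_geF; have := HB v; rewrite mul0r => HBv.
  have t0C : t%:C < 0 by rewrite ltcR.
  have vC : 0 < sqnorm v.
    by rewrite lt_def sqnorm_ge0 andbT; apply: contraNneq v0 => /sqnorm_eq0 ->.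
  have eC : 0 < (e / 2)%:C by rewrite ltcR divr_gt0.
  rewrite ltrBlDr add0r; apply: (@le_lt_trans _ _ 0).
    by rewrite nmulr_rle0.
  by rewrite mulr_gt0 // mulr_gt0 // nmulr_rgt0.
- move=> HM tau; rewrite le_eqVlt => /predU1P[<-|tau0].
    by rewrite scale0r addr0 det1 oner_neq0.
  have t0 : - tau^-1 < 0 by rewrite oppr_lt0 invr_gt0.
  have -> : tau = - (- tau^-1)^-1 by rewrite invrN invrK opprK.
  by rewrite det_pencil_eq0 // HM.
Qed.
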